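(* If $\kappa$ is a Mahlo cardinal, then for every meta-ordinal term $t$ having only ordinals less than $\kappa$, the cardinal $\kappa$ is $t$-inaccessible.
   Context: A cardinal is inaccessible if it is an uncountable regular strong limit cardinal. An infinite cardinal $\kappa$ is Mahlo if and only if the set of inaccessible cardinals below $\kappa$ is stationary in $\kappa$. Meta-ordinal terms: $\Omega$ is a formal symbol (standing for the order type of Ord). A meta-ordinal term is a formal finite expression $t=\Omega^{\alpha}\cdot\beta+\Omega^{\eta}\cdot\gamma+\dots+\Omega\cdot\delta+\sigma$ with exponents $\alpha>\eta>\dots$ strictly decreasing ordinals and coefficients $\beta,\gamma,\dots,\delta,\sigma$ ordinals. Terms are ordered lexicographically as in Cantor normal form: first compare the highest powers of $\Omega$; if equal, compare their coefficients; if equal, compare the next highest powers of $\Omega$, and so on. ''The ordinals of $t$'' are the exponents and coefficients occurring in $t$. Definition (by recursion): if $t$ is a meta-ordinal term with ordinals less than $\kappa$, then a cardinal $\kappa$ is $t$-inaccessible if and only if $\kappa$ is inaccessible and for every meta-ordinal term $s<t$ having ordinals less than $\kappa$, the cardinal $\kappa$ is a limit of $s$-inaccessible cardinals. *)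

(* Defs.v *)
From mathcomp Require Import all_boot all_order.
From mathcomp Require Import boolp classical_sets functions cardinality.
From mathcomp Require wochoice.

Set Implicit Arguments.
Unset Strict Implicit.
Unset Printing Implicit Defensive.

Import Order.Theory.

Local Open Scope classical_set_scope.
Local Open Scope card_scope.
Local Open Scope order_scope.

(* Ordinals are the elements of a well-ordered type [T], so that [T] plays the
   role of Ord.  The ordinal [k] is identified with its initial segment
   [seg k]; every notion below depends on [k] only through [seg k]. *)
Definition well_ordered d (T : orderType d) : Prop :=
  wochoice.well_order (<=%O : rel T).

Definition seg d (T : orderType d) (k : T) : set T := [set a | a < k].

Definition is_cardinal d (T : orderType d) (k : T) : Prop :=
  forall a : T, a < k -> ~ (seg a #= seg k).

Definition infinite_cardinal d (T : orderType d) (k : T) : Prop :=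
  is_cardinal k /\ infinite_set (seg k).

(* [A] may extend beyond [k].  The first clause excludes [k = 0]; no successor
   ordinal is a limit of anything because [b < a] is strict. *)
Definition limit_of d (T : orderType d) (A : set T) (k : T) : Prop :=
  seg k !=set0 /\ forall b : T, b < k -> exists a : T, [/\ A a, b < a & a < k].

(* [k] has cofinality [k]: the cofinality of a limit ordinal is the least
   cardinality of an unbounded subset. *)
Definition regular_cardinal d (T : orderType d) (k : T) : Prop :=
  infinite_cardinal k /\
  forall A : set T, A `<=` seg k -> limit_of A k -> A #= seg k.

(* [2 ^ |a| < k] for every [a < k] *)
Definition strong_limit d (T : orderType d) (k : T) : Prop :=
  forall a : T, a < k ->
    let pow := [set B : set T | B `<=` seg a] in
    pow #<= seg k /\ ~ (seg k #<= pow).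

Definition inaccessible d (T : orderType d) (k : T) : Prop :=
  [/\ ~ countable (seg k), regular_cardinal k & strong_limit k].

Definition club_in d (T : orderType d) (k : T) (C : set T) : Prop :=
  [/\ C `<=` seg k, limit_of C k
    & forall a : T, a < k -> limit_of C a -> C a].

Definition stationary_in d (T : orderType d) (k : T) (S : set T) : Prop :=
  forall C : set T, club_in k C -> S `&` C !=set0.

Definition mahlo d (T : orderType d) (k : T) : Prop :=
  infinite_cardinal k /\
  stationary_in k [set a | a < k /\ inaccessible a].

(* The term Omega^a * b + Omega^e * c + ... is the sequence of its summands
   [:: (a, b); (e, c); ...], by strictly decreasing exponents.  As in Cantor
   normal form only nonzero summands are written, so that the term 0 is [::];
   the final ordinal sigma, if nonzero, is the summand of exponent 0. *)
Definition term_wf d (T : orderType d) (t : seq (T * T)) : bool :=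
  sorted (fun p q : T * T => q.1 < p.1) t &&
  all (fun p : T * T => `[< seg p.2 !=set0 >]) t.

Record meta_term d (T : orderType d) := MetaTerm {
  summands : seq (T * T);
  summandsP : term_wf summands }.

(* Lexicographic comparison of summands, leading ones first, each summand being
   compared by its exponent and then by its coefficient; a proper prefix is
   smaller. *)
Definition term_lt d (T : orderType d) (s t : meta_term T) : Prop :=
  ((summands s : seqlexi (T *l T)) < (summands t : seqlexi (T *l T)))%O.

Definition ordinals_below d (T : orderType d) (k : T) (t : meta_term T) : Prop :=
  forall p : T * T, p \in summands t -> p.1 < k /\ p.2 < k.

(* [t_inaccessible t k]: the ordinals of [t] are below [k], and [k] is
   [t]-inaccessible.  The cardinals in the recursive clause are below [k], so on
   a well-ordered [T] the recursion equation [t_inaccessibleE] determines this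
   predicate. *)
Inductive t_inaccessible d (T : orderType d) (t : meta_term T) (k : T) : Prop :=
| TInaccessible of
    ordinals_below k t
  & inaccessible k
  & (forall s : meta_term T, term_lt s t -> ordinals_below k s ->
       limit_of (t_inaccessible s) k).

Lemma t_inaccessibleE d (T : orderType d) (t : meta_term T) (k : T) :
  ordinals_below k t ->
  t_inaccessible t k <->
  inaccessible k /\
  (forall s : meta_term T, term_lt s t -> ordinals_below k s ->
     limit_of (t_inaccessible s) k).
Proof. by move=> kt; split=> [[]|[]]. Qed.

(* Main.v *)
(* A Mahlo cardinal [k] is inaccessible.  By induction on the term [t], it
   suffices to show that if [k] is [s]-inaccessible, then it is a limit of
   [s]-inaccessible cardinals.  The [c < k] that are limits of [r]-inaccessibles
   for every [r < s] with ordinals below [c] form a club: for unboundedness,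
   iterate [omega] times a function [h] such that every such [r] with ordinals
   below [y] has an [r]-inaccessible between [y] and [h y].  Stationarity gives
   inaccessible [c] arbitrarily high in this club, and these are
   [s]-inaccessible. *)
Require Import Defs.
From mathcomp Require Import all_boot all_order.
From mathcomp Require Import boolp classical_sets functions cardinality.

Set Implicit Arguments.
Unset Strict Implicit.
Unset Printing Implicit Defensive.

Import Order.Theory.

Local Open Scope classical_set_scope.
Local Open Scope card_scope.
Local Open Scope order_scope.

(** * Cardinality and well-orders *)

Lemma card_le_inj T U (A : set T) (B : set U) (f : T -> U) :
  (forall x, A x -> B (f x)) -> {in A &, injective f} -> A #<= B.
Proof.
move=> AB /inj_card_eq; rewrite card_eq_sym => /card_eqPle[Af _].
by apply: card_le_trans Af (subset_card_le _) => _ [x Ax <-]; exact: AB.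
Qed.

Lemma infinite_set_nat_inj T (A : set T) :
  infinite_set A -> exists f : nat -> T, injective f /\ forall n, A (f n).
Proof.
elim/Ppointed: T => T in A *; first by rewrite emptyE => /infinite_setN0[].
move=> /infiniteP/pcard_leP[f]; exists f; split=> [m n fmn|n].
  by apply: (@inj _ _ _ f m n); rewrite ?inE.
exact: funS.
Qed.

(* Hilbert's hotel: [a |-> f 0], [f n |-> f n.+1]. *)
Lemma infinite_setU1_card_eq (T : eqType) (a : T) (A : set T) :
  infinite_set A -> A #= a |` A.
Proof.
move=> Ainf; have [f [finj fA]] := infinite_set_nat_inj Ainf.
have [Aa|Aa] := pselect (A a).
  by rewrite setUidr => // x ->.
rewrite card_eq_le subset_card_le /=; last by move=> x; right.
(* The [xget] finds the index of [x] in the sequence [f], unique as [f] is injective; its default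
   [0] is never reached. *)
pose g x := if x == a then f 0%N else
  if pselect (exists n, f n = x) is left e then f (xget 0%N [set n | f n = x]).+1
  else x.
have ga : g a = f 0%N by rewrite /g eqxx.
have gf n : g (f n) = f n.+1.
  rewrite /g; case: eqP => [fna|_]; first by case: Aa; rewrite -fna.
  case: pselect => [e|[]]; last by exists n.
  by congr (f _.+1); apply: finj; exact: (@xgetI _ 0%N [set m | f m = f n] n).
have gN x : x != a -> (forall n, f n <> x) -> g x = x.
  move=> /negPf xa fx; rewrite /g xa; case: pselect => // -[n fn].
  by have := fx n.
have cases x :
    (x = a \/ exists n, x = f n) \/ (x != a /\ forall n, f n <> x).
  case: (eqVneq x a) => [->|xa]; first by left; left.
  have [[n fn]|fx] := pselect (exists n, f n = x); first by left; right; exists n.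
  by right; split=> // n fn; apply: fx; exists n.
have gcases x :
    (exists n, g x = f n /\ x = if n is n'.+1 then f n' else a)
    \/ (g x = x /\ forall n, f n <> x).
  case: (cases x) => [[->|[n ->]]|[xa fx]].
  - by left; exists 0%N; rewrite ga.
  - by left; exists n.+1; rewrite gf.
  - by right; rewrite gN.
apply: (@card_le_inj _ _ _ _ g).
  move=> x aAx; case: (cases x) => [[->|[n ->]]|[xa fx]].
  - by rewrite ga.
  - by rewrite gf.
  - by rewrite gN//; case: aAx xa => [->|//]; rewrite eqxx.
move=> x y _ _ gxy.
case: (gcases x) => [[n [gx ->]]|[gx fx]]; case: (gcases y) => [[n' [gy ->]]|[gy fy]].
- by move: gxy; rewrite gx gy => /finj ->.
- by case: (fy n); rewrite -gx gxy.
- by case: (fx n'); rewrite -gy -gxy.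
- by rewrite -gx gxy.
Qed.

Lemma wo_min d (T : orderType d) (Twf : well_ordered T) (P : set T) :
  P !=set0 -> exists z, P z /\ forall y, P y -> z <= y.
Proof.
move=> [x Px]; case: (Twf [pred x | `[<P x>]]).
  by exists x; apply/asboolP.
move=> z [[/asboolP Pz zmin] _]; exists z; split=> // y Py.
by apply: zmin; apply/asboolP.
Qed.

Lemma wo_wf d (T : orderType d) (Twf : well_ordered T) :
  well_founded (fun x y : T => x < y).
Proof.
move=> x; apply: contrapT => xacc.
have [|z [zacc zmin]] := wo_min Twf (P := [set x | ~ Acc (fun x y : T => x < y) x]).
  by exists x.
apply: zacc; constructor => y yz; apply: contrapT => /zmin.
by rewrite leNgt yz.
Qed.

(** * Initial segments, cardinals and regularity *)

Lemma seg_nonempty d (T : orderType d) (a k : T) : a < k -> seg k !=set0.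
Proof. by move=> ak; exists a. Qed.

Lemma seg_card_le d (T : orderType d) (a b : T) : a <= b -> seg a #<= seg b.
Proof. by move=> ab; apply: subset_card_le => x /lt_le_trans; exact. Qed.

Lemma cardinal_NleP d (T : orderType d) (a k : T) :
  is_cardinal k -> a < k -> ~ (seg k #<= seg a).
Proof.
by move=> kc ak ka; apply: (kc _ ak); rewrite card_eq_le ka seg_card_le// ltW.
Qed.

(** If nothing lay between [b] and [k], then [seg k] would be [seg b] plus one point, hence
    equinumerous with [seg b]. *)
Lemma infinite_cardinal_limit d (T : orderType d) (k : T) :
  infinite_cardinal k -> limit_of setT k.
Proof.
move=> [kc kinf]; split; first exact: infinite_setN0.
move=> b bk; apply: contrapT => nb; apply: (kc _ bk).
have segk : seg k = b |` seg b.
  apply/seteqP; split=> x /=.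
    move=> xk; have [xb|bx|->] := ltgtP x b; [by right| |by left].
    by case: nb; exists x.
  by move=> [->//|xb]; exact: lt_trans xb bk.
rewrite segk; apply: infinite_setU1_card_eq => bfin; apply: kinf.
by rewrite segk finite_setU; split.
Qed.

Lemma infinite_cardinal_succ d (T : orderType d) (k x : T) :
  infinite_cardinal k -> x < k -> exists2 y, x < y & y < k.
Proof. by move=> /infinite_cardinal_limit[_ +] xk => /(_ _ xk)[y [_ *]]; exists y. Qed.

(** Otherwise the range of [g] is unbounded in [k], so it has cardinality [k] by regularity,
    although it is an image of [D]. Later [D] is a segment or, for uncountable [k], all of [nat]. *)
Lemma regular_bound d (T : orderType d) (k : T) I (D : set I) (g : I -> T) :
  regular_cardinal k -> (forall i, D i -> g i < k) -> ~ (seg k #<= D) ->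
  exists2 y, y < k & forall i, D i -> g i < y.
Proof.
move=> [kic kreg] gk kD; apply: contrapT => ub; apply: kD.
have limD : limit_of (g @` D) k.
  split; first by have [] := infinite_cardinal_limit kic.
  move=> b bk; apply: contrapT => nb; apply: ub.
  have [y by' yk] := infinite_cardinal_succ kic bk.
  exists y => // i Di; rewrite (le_lt_trans _ by')// leNgt; apply/negP => bi.
  by apply: nb; exists (g i); split=> //; exact: gk.
have : g @` D #= seg k by apply: kreg limD => _ [i Di <-]; exact: gk.
by move=> /card_eqPle[_ /card_le_trans]; apply; exact: card_image_le.
Qed.

(* The collapse sends [x] to the order type of the elements of [A] below [x]. *)
Lemma subset_seg_card d (T : orderType d) (Twf : well_ordered T) (k : T)
    (A : set T) :
  A `<=` seg k -> A #= seg k \/ exists2 m, m < k & A #<= seg m.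
Proof.
move=> Ak.
(* The value at [x] is the least strict upper bound of the values at the [z] in [A] below [x]. The
   default [k] never arises: by [gle], [x] itself is such a bound. *)
pose F x (g : forall z, z < x -> T) : T :=
  xget k [set y | (forall z (zx : z < x), A z -> g z zx < y) /\
    forall y', (forall z (zx : z < x), A z -> g z zx < y') -> y <= y'].
pose g := Fix (wo_wf Twf) (fun _ => T) F.
have gE x : g x = F x (fun z _ => g z).
  apply: (Fix_eq (wo_wf Twf) (fun _ => T) F) => {}x f f' ff'; congr F.
  by apply: functional_extensionality_dep => z; apply: functional_extensionality_dep.
have gmin x : (exists y, forall z, z < x -> A z -> g z < y) ->
    (forall z, z < x -> A z -> g z < g x) /\
    forall y, (forall z, z < x -> A z -> g z < y) -> g x <= y.
  move=> ex; rewrite [g x]gE /F; case: xgetP => [y _ //|] none.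
  by have [z zP] := wo_min Twf ex; case: (none z).
have gle x : g x <= x.
  elim/(well_founded_ind (wo_wf Twf)): x => x IH.
  have xub z : z < x -> A z -> g z < x.
    by move=> zx Az; exact: le_lt_trans (IH _ zx) zx.
  by have [|_] := gmin x; [exists x|apply].
have gmono x z : z < x -> A z -> g z < g x.
  have [|+ _] := gmin x; last by apply.
  by exists x => y yx _; exact: le_lt_trans (gle y) yx.
have ginj : {in A &, injective g}.
  move=> x y /set_mem Ax /set_mem Ay gxy; case: (ltgtP x y) => // xy.
    by have := gmono _ _ xy Ax; rewrite gxy ltxx.
  by have := gmono _ _ xy Ay; rewrite gxy ltxx.
(* If [g] omits some [m < k] on [A], induction keeps its values below [m]; otherwise its values on
   [A] cover [seg k]. *)
have [[m mk mA]|full] := pselect (exists2 m, m < k & forall x, A x -> g x <> m).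
  right; exists m => //; apply: (card_le_inj (f := g)) => // x.
  elim/(well_founded_ind (wo_wf Twf)): x => x IH Ax; rewrite /seg /=.
  have mub z : z < x -> A z -> g z < m by move=> zx; exact: IH.
  have [|_ /(_ m mub)] := gmin x; first by exists m.
  by rewrite le_eqVlt => /orP[/eqP/mA|].
left; rewrite card_eq_le subset_card_le//=.
have : seg k `<=` g @` A.
  move=> m mk; apply: contrapT => mA; apply: full; exists m => // x Ax gx.
  by apply: mA; exists x.
by move=> /subset_card_le/card_le_trans; apply; exact: card_image_le.
Qed.

(* If [b] were the largest element of [seg k], then [x |-> seg x] would inject
   [seg k] into the power set of [seg b]. *)
Lemma strong_limit_succ d (T : orderType d) (k b : T) :
  strong_limit k -> b < k -> exists2 a, b < a & a < k.
Proof.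
move=> ksl bk; apply: contrapT => nb; have [_] := ksl b bk; apply.
apply: (card_le_inj (f := @seg d T)) => [x xk y yx|x y _ _ /seteqP[xy yx]].
  rewrite /seg /= (lt_le_trans yx)// leNgt; apply/negP => bx.
  by apply: nb; exists x.
by case: (ltgtP x y) => [/yx|/xy|//]; rewrite /seg /= ltxx.
Qed.

(** * Mahlo cardinals are inaccessible *)

(** The ordinals strictly between [b] and [k] form a club. *)
Lemma mahlo_above d (T : orderType d) (k b : T) :
  mahlo k -> b < k -> exists a, [/\ b < a, a < k & inaccessible a].
Proof.
move=> [kic kstat] bk.
have [] := kstat [set c | b < c /\ c < k]; last first.
  by move=> a [[ak ai] [ba _]]; exists a.
split=> [c []//||a ak [[z za] /(_ _ za)[c [[bc _] _ ca]]]]; last first.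
  by split=> //; exact: lt_trans ca.
split; first exact: seg_nonempty bk.
move=> x xk; have mk : Order.max b x < k by rewrite gt_max bk.
have [y my yk] := infinite_cardinal_succ kic mk.
by move: my; rewrite gt_max => /andP[by' xy]; exists y.
Qed.

(* An inaccessible [c > m] cannot be a limit of [A] when [|A| <= m], so if the
   unbounded [A] is smaller than [k], then the successors and the limits of
   elements of [A] contain a club without inaccessibles. *)
Lemma mahlo_regular d (T : orderType d) (Twf : well_ordered T) (k : T) :
  mahlo k -> regular_cardinal k.
Proof.
move=> kM; have [kic kstat] := kM; split=> // A Ak limA.
have [//|[m mk Am]] := subset_seg_card Twf Ak; exfalso.
pose C : set T := [set c | [/\ c < k, m < c & limit_of A c \/
  exists a, [/\ A a, a < c & forall b, b < c -> b <= a]]].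
have [] := kstat C; last first.
  move=> c [[ck [_ [[cc cinf] creg] csl]] [_ mc [limc|[a [Aa ac amax]]]]].
    have : A `&` seg c #= seg c.
      apply: creg; first by move=> x [].
      split=> [|b bc]; first exact: seg_nonempty mc.
      by case: limc => _ /(_ b bc)[a [Aa ba ac]]; exists a.
    move=> /card_eqPle[_] /card_le_trans/(_ (subset_card_le (@subIsetl _ _ _))).
    by move=> /card_le_trans/(_ Am); exact: cardinal_NleP.
  have [b ab /amax] := strong_limit_succ csl ac.
  by rewrite leNgt ab.
split=> [c []//||c ck [c0 limc]].
  split; first exact: seg_nonempty mk.
  move=> b bk; have mbk : Order.max m b < k by rewrite gt_max mk.
  case: limA => _ /(_ _ mbk)[a [Aa + ak]].
  rewrite gt_max => /andP[ma ba].
  have [|c [ac cmin]] := wo_min Twf (P := [set c | a < c]); first by exists k.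
  have ck : c < k.
    have [y ay yk] := infinite_cardinal_succ kic ak.
    exact: le_lt_trans (cmin _ ay) yk.
  exists c; split=> //; last exact: lt_trans ac.
  split=> //; first exact: lt_trans ac.
  right; exists a; split=> // x xc; rewrite leNgt; apply/negP => /cmin.
  by rewrite leNgt xc.
split=> //.
  by case: c0 => z /limc[c' [[_ mc' _] _ c'c]]; exact: lt_trans c'c.
(* Some [a] in [A] satisfies [c1 <= a < c2], whether [c2] is a limit of [A] or the successor of an
   element of [A]. Hence limits of [C] are limits of [A]. *)
left; split=> // b bc; have [c1 [_ bc1 c1c]] := limc _ bc.
have [c2 [[_ _ +] c12 c2c]] := limc _ c1c.
move=> [[_ /(_ _ c12)[a [Aa c1a ac2]]]|[a [Aa ac2 /(_ _ c12) c1a]]].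
  by exists a; split=> //; [exact: lt_trans c1a|exact: lt_trans c2c].
by exists a; split=> //; [exact: lt_le_trans c1a|exact: lt_trans c2c].
Qed.

(** Uncountability and the strong limit property pass up to [k] from the inaccessibles below it,
    which are unbounded by [mahlo_above]. *)
Lemma mahlo_inaccessible d (T : orderType d) (Twf : well_ordered T) (k : T) :
  mahlo k -> inaccessible k.
Proof.
move=> kM; have kreg := mahlo_regular Twf kM.
split=> //.
  have [[_ kinf] _] := kM; have [b bk] := infinite_setN0 kinf.
  have [a [_ ak [aunc _ _]]] := mahlo_above kM bk.
  by apply: contra_not aunc; apply: sub_countable; exact/seg_card_le/ltW.
move=> a ak pow; have [b [ab bk [_ _ bsl]]] := mahlo_above kM ak.
have [pb bp] := bsl _ ab; have bk' := seg_card_le (ltW bk).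
split; first exact: card_le_trans bk'.
by move=> kp; apply: bp; exact: card_le_trans kp.
Qed.

(** * Well-foundedness of the order of terms *)

Lemma lexi_pair_wf d (T : orderType d) (Twf : well_ordered T) :
  well_founded (fun p q : T *l T => p < q).
Proof.
suff acc a b : Acc (fun p q : T *l T => p < q) (a, b) by move=> [a b]; exact: acc.
elim/(well_founded_ind (wo_wf Twf)): a b => a IHa.
elim/(well_founded_ind (wo_wf Twf)) => b IHb.
constructor=> -[a' b']; rewrite ltxi_pair => /andP[aa' bb'].
have [lt_a|] := boolP (a' < a); first exact: IHa.
rewrite -leNgt => le_a; have a'E : a' = a by apply/le_anti/andP.
by rewrite a'E; apply: IHb; exact: (implyP bb').
Qed.

Lemma term_wf_cons d (T : orderType d) (p : T * T) (u : seq (T * T)) :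
  term_wf (p :: u) -> term_wf u /\ forall q, q \in u -> q.1 < p.1.
Proof.
move=> /andP[/= pu /andP[_ uall]]; split.
  by rewrite /term_wf uall (path_sorted pu).
have tr : transitive (fun p q : T * T => q.1 < p.1).
  by move=> y x z yx zy; exact: lt_trans yx.
by move=> q qu; exact: (allP (order_path_min tr pu) q qu).
Qed.

(* Exponents decrease along a term, so the tail [u] of [p :: u] has a head
   smaller than [p], and [u] is accessible by induction on the head. *)
Lemma term_lt_wf d (T : orderType d) (Twf : well_ordered T) :
  well_founded (@term_lt d T).
Proof.
(* The smaller sequence must be well-formed, because the lexicographic order on arbitrary sequences
   need not be well-founded. *)
pose R (u v : seq (T * T)) :=
  term_wf u /\ ((u : seqlexi (T *l T)) < (v : seqlexi (T *l T)))%O.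
have R0 : Acc R [::] by constructor=> -[|q v] [].
have Rcons (p : T * T) u : term_wf (p :: u) -> Acc R (p :: u).
  elim/(well_founded_ind (lexi_pair_wf Twf)): p u => p IHp u.
  move=> pu; have : Acc R u.
    case: u pu => [//|q u] /term_wf_cons[qu /(_ q (mem_head _ _)) qp].
    apply: IHp => //; case: p q qp {qu} => [a b] [a' b'] /= aa'.
    by rewrite ltxi_pair ltW//= leNgt aa'.
  move=> uacc; elim: uacc pu => {}u _ IHu pu.
  constructor=> -[//|q v] [qv]; rewrite ltxi_cons => /andP[qp vu].
  have [lt_q|] := boolP ((q : T *l T) < p); first exact: IHp.
  rewrite -leNgt => le_q; have qE : q = p by apply: (@le_anti _ (T *l T)%type); apply/andP.
  rewrite {}qE in qv vu *; apply: IHu => //; split.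
    by case: (term_wf_cons qv).
  exact: (implyP vu).
suff acc u : Acc R u -> forall t : meta_term T, summands t = u -> Acc (@term_lt d T) t.
  move=> t; have Racc u : term_wf u -> Acc R u.
    case: u => [_|p u]; [exact: R0 | exact: Rcons].
  exact: (acc _ (Racc _ (summandsP t)) t erefl).
elim=> {}u _ IH t tu; constructor=> s st; apply: (IH (summands s)) => //.
by split; [exact: summandsP | rewrite -tu].
Qed.

(** * Bounds and closure points below an inaccessible *)

(** A term has only finitely many ordinals, so their maximum stays below the limit [c]. *)
Lemma limit_ordinals_below d (T : orderType d) (c : T) (t : meta_term T) :
  limit_of setT c -> ordinals_below c t -> exists2 e, e < c & ordinals_below e t.
Proof.
move=> [[e0 e0c] limc]; rewrite /ordinals_below; elim: (summands t) => [_|p u IH].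
  by exists e0.
move=> pu; have [|e ec eu] := IH; first by move=> q qu; apply: pu; rewrite inE qu orbT.
have [p1 p2] := pu p (mem_head _ _).
have mc : Order.max e (Order.max p.1 p.2) < c by rewrite !gt_max ec p1.
have [y [_ + yc]] := limc _ mc; rewrite !gt_max => /and3P[ey y1 y2].
exists y => // q; rewrite inE => /orP[/eqP->//|/eu[q1 q2]].
by split; [exact: lt_trans q1 ey | exact: lt_trans q2 ey].
Qed.

Lemma inaccessible_limit d (T : orderType d) (k : T) :
  inaccessible k -> limit_of setT k.
Proof. by move=> [_ [/infinite_cardinal_limit]]. Qed.

(** Induction on the length, in place of a count of the sequences: [G p] bounds [F] on the sequences
    with head [p], and regularity bounds [G] over the second coordinates, then over the first. *)
Lemma regular_bound_seq d (T : orderType d) (k x : T) (n : nat)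
    (F : seq (T * T) -> T) :
  regular_cardinal k -> x < k -> (forall u, F u < k) ->
  exists2 y, y < k & forall u, size u = n ->
    (forall p, p \in u -> p.1 < x /\ p.2 < x) -> F u < y.
Proof.
move=> kreg xk; have [[kc _] _] := kreg.
elim: n F => [|n IH] F Fk.
  have [y ly yk] := infinite_cardinal_succ kreg.1 (Fk [::]).
  by exists y => // u /size0nil ->.
have /choice[G GP] (p : T * T) : exists y, y < k /\ forall u, size u = n ->
    (forall p, p \in u -> p.1 < x /\ p.2 < x) -> F (p :: u) < y.
  by have [y yk yP] := IH (fun u => F (p :: u)) (fun u => Fk _); exists y.
have bnd (g : T -> T) : (forall a, g a < k) -> exists y, y < k /\
    forall a, a < x -> g a < y.
  move=> gk; have [|y yk gy] := regular_bound (D := seg x) kreg (fun a _ => gk a).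
    exact: cardinal_NleP kc xk.
  by exists y.
have /choice[H HP] a : exists y, y < k /\ forall b, b < x -> G (a, b) < y.
  by apply: (bnd (fun b => G (a, b))) => b; case: (GP (a, b)).
have [y [yk yP]] := bnd H (fun a => (HP a).1).
exists y => // -[//|[a b] u] [su] ux.
have [ax bx] := ux _ (mem_head _ _).
apply: lt_trans (yP _ ax); apply: lt_trans ((HP a).2 _ bx).
by apply: (GP (a, b)).2 => // p pu; apply: ux; rewrite inE pu orbT.
Qed.

(** Each length is bounded separately; the countably many bounds have a common one since [k] is
    regular and uncountable. *)
Lemma inaccessible_bound_terms d (T : orderType d) (k x : T)
    (F : meta_term T -> T) :
  inaccessible k -> x < k -> (forall t, F t < k) ->
  exists2 y, y < k & forall t, ordinals_below x t -> F t < y.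
Proof.
move=> [kunc kreg _] xk Fk.
pose G u := if pselect (term_wf u) is left w then F (MetaTerm w) else x.
have Gk u : G u < k by rewrite /G; case: pselect.
have /choice[y yP] (n : nat) : exists y, y < k /\ forall u, size u = n ->
    (forall p, p \in u -> p.1 < x /\ p.2 < x) -> G u < y.
  by have [y yk yP] := regular_bound_seq n kreg xk Gk; exists y.
have [|z zk zP] := regular_bound (D := setT) kreg (fun n _ => (yP n).1).
  exact: kunc.
exists z => // t tx; apply: lt_trans (zP (size (summands t)) I).
have := (yP _).2 _ erefl tx; rewrite /G; case: pselect => [w|]; last first.
  by case; exact: summandsP.
by case: t tx w => u wu _ w; rewrite (bool_irrelevance w wu).
Qed.

(** [c] is the supremum of the iterates of [h] from [m]. As [h] need not be monotone, [h x < c] is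
    claimed only for cofinally many [x], namely the iterates. *)
Lemma inaccessible_closure_point d (T : orderType d) (Twf : well_ordered T)
    (k m : T) (h : T -> T) :
  inaccessible k -> m < k -> (forall x, x < k -> x < h x < k) ->
  exists c, [/\ m < c, c < k &
    forall b, b < c -> exists x, [/\ b <= x, x < c & h x < c]].
Proof.
move=> [kunc kreg _] mk hP.
pose s n := iter n h m.
have sk n : s n < k by elim: n => //= n /hP/andP[].
have ss n : s n < s n.+1 by have /andP[] := hP _ (sk n).
have [|y yk yP] := regular_bound (D := setT) kreg (fun n _ => sk n).
  exact: kunc.
have [|c [sc cmin]] := wo_min Twf (P := [set c | forall n, s n < c]).
  by exists y => n; exact: yP.
exists c; split; [exact: sc 0%N| |].
  by apply: le_lt_trans yk; apply: cmin => n; exact: yP.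
move=> b bc; have [[n bn]|nb] := pselect (exists n, b <= s n).
  by exists (s n); split=> //; exact: sc n.+1.
have /cmin : forall n, s n < b.
  by move=> n; rewrite ltNge; apply/negP => bn; apply: nb; exists n.
by rewrite leNgt bc.
Qed.

(** * Reflecting inaccessibility below a Mahlo cardinal *)

Lemma t_inaccessible_mahlo_limit d (T : orderType d) (Twf : well_ordered T)
    (k : T) (s : meta_term T) :
  mahlo k -> t_inaccessible s k -> limit_of (t_inaccessible s) k.
Proof.
move=> kM [sk ki slim]; have [_ kstat] := kM.
have limk := inaccessible_limit ki; have kic := kM.1.
split=> [|b bk]; first by case: limk.
(* Every [c] above [e] has the ordinals of [s] below it. *)
have [e ek se] := limit_ordinals_below limk sk.
have mk : Order.max b e < k by rewrite gt_max bk.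
set m := Order.max b e in mk.
pose C : set T := [set c | [/\ m < c, c < k & forall r, term_lt r s ->
  ordinals_below c r -> limit_of (t_inaccessible r) c]].
suff [c [[ck ci] [mc _ cC]]] : [set a | a < k /\ inaccessible a] `&` C !=set0.
  move: mc; rewrite /m gt_max => /andP[bc ec].
  exists c; split=> //; constructor=> // p /se[p1 p2].
  by split; [exact: lt_trans ec | exact: lt_trans ec].
apply: kstat; split=> [c []//||c ck [[c0 c0c] limc]]; last first.
  have mc : m < c by have [c' [[mc' _ _] _]] := limc _ c0c; exact: lt_trans.
  split=> // r rs rc; split=> [|x xc]; first exact: seg_nonempty mc.
  have limcT : limit_of setT c.
    split=> [|y /limc[y' [_ ? ?]]]; first exact: seg_nonempty mc.
    by exists y'.
  (* Any [c'] of [C] past [f] has the ordinals of [r] below it, so it is a limit of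
     [r]-inaccessibles. *)
  have [f fc rf] := limit_ordinals_below limcT rc.
  have xfc : Order.max x f < c by rewrite gt_max xc.
  have [c' [[_ _ c'C] + c'c]] := limc _ xfc; rewrite gt_max => /andP[xc' fc'].
  have [|_ /(_ _ xc')[a [ra xa ac']]] := c'C r rs.
    by move=> p /rf[p1 p2]; split; [exact: lt_trans fc' | exact: lt_trans fc'].
  by exists a; split=> //; exact: lt_trans c'c.
split=> [|x xk]; first exact: seg_nonempty bk.
have /choice[h hP] y : exists z, y < k -> [/\ y < z, z < k &
    forall r, term_lt r s -> ordinals_below y r ->
      exists a, [/\ t_inaccessible r a, y < a & a < z]].
  have [yk|/negP ky] := boolP (y < k); last by exists y.
  (* [F r] picks an [r]-inaccessible above [y], with default [y] to stay below [k] for every term;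
     [z'] makes the value of [h] exceed [y]. *)
  pose P r : set T := [set a | [/\ t_inaccessible r a, y < a & a < k]].
  pose F r := xget y (P r).
  have Fk r : F r < k by rewrite /F; case: xgetP => // z _ [].
  have [z zk zP] := inaccessible_bound_terms ki yk Fk.
  have [z' z'P z'k] := infinite_cardinal_succ kic yk.
  have zz'k : Order.max z z' < k by rewrite gt_max zk.
  exists (Order.max z z') => _; split=> //; first by rewrite lt_max z'P orbT.
  move=> r rs ry; have rk : ordinals_below k r.
    by move=> p /ry[p1 p2]; split; [exact: lt_trans yk | exact: lt_trans yk].
  have [a aP] := (slim r rs rk).2 _ yk.
  have [ra ya _] : P r (F r) := xgetI y (P := P r) aP.
  by exists (F r); split=> //; rewrite lt_max zP.
have mxk : Order.max m x < k by rewrite gt_max mk.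
have [|c [+ ck cP]] := inaccessible_closure_point Twf (h := h) ki mxk.
  by move=> y /hP[-> ->].
rewrite gt_max => /andP[mc xc]; exists c; split=> //; split=> // r rs rc.
have limcT : limit_of setT c.
  split=> [|y /cP[y' [yy' y'c hy'c]]]; first exact: seg_nonempty mc.
  have [y'h _ _] := hP _ (lt_trans y'c ck).
  by exists (h y'); split=> //; exact: le_lt_trans yy' y'h.
have [f fc rf] := limit_ordinals_below limcT rc.
split=> [|y yc]; first exact: seg_nonempty mc.
have yfc : Order.max y f < c by rewrite gt_max yc.
(* The ordinals of [r] are below [z], so there is an [r]-inaccessible between [z] and [h z], hence
   between [y] and [c]. *)
have [z [+ zc hzc]] := cP _ yfc; rewrite ge_max => /andP[yz fz].
have [_ _ /(_ r rs)[|a [ra za ahz]]] := hP _ (lt_trans zc ck).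
  by move=> p /rf[p1 p2]; split; [exact: lt_le_trans fz | exact: lt_le_trans fz].
by exists a; split=> //; [exact: le_lt_trans za | exact: lt_trans hzc].
Qed.

Theorem theorem11 (d : Order.disp_t) (T : orderType d) (Twf : well_ordered T)
    (k : T) :
  mahlo k ->
  forall t : meta_term T, ordinals_below k t -> t_inaccessible t k.
Proof.
move=> kM; elim/(well_founded_ind (term_lt_wf Twf)) => t IH tk.
constructor=> //; first exact: mahlo_inaccessible.
by move=> s st sk; apply: t_inaccessible_mahlo_limit => //; exact: IH.
Qed.
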